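(* Let $p>2$. Assume that there exist positive constants $V_1,V_2,A_1(p)$ and $A_2(p)$ such that $$\mathbb E\big[(G_{X_1}(X_1))^2\big]\le V_1,\quad\mathbb E\big[(G_\varepsilon(\varepsilon))^2\big]\le V_2,\quad\|G_{X_1}(X_1)\|_{w,p}^p\le A_1(p)\quad\text{and}\quad\|G_\varepsilon(\varepsilon)\|_{w,p}^p\le A_2(p).$$ Let $V=V_1(K_{n-1}(\rho))^2+V_2\sum_{i=2}^n(K_{n-i}(\rho))^2$ and $A(p)=A_1(p)+(n-1)A_2(p)$. Then, for any $x,y>0$, $$\mathbb P(\pm S_n>x)\le H_n\left(\frac{x}{yK_{n-1}(\rho)},\frac{\sqrt V}{yK_{n-1}(\rho)}\right)+\frac{A(p)}{y^p},$$ where $$H_n(x,v)=\left\{\Big(\frac{v^2}{x+v^2}\Big)^{x+v^2}\Big(\frac{n}{n-x}\Big)^{n-x}\right\}^{\frac{n}{n+v^2}}\mathbf 1_{\{x\le n\}}$$ with the convention that $(+\infty)^0=1$ (which applies when $x=n$).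
   Context: $(\mathcal X,d)$ and $(\mathcal Y,\delta)$ are complete separable metric spaces; $(\varepsilon_i)_{i\ge1}$ is a sequence of iid $\mathcal Y$-valued random variables; $X_1$ is an $\mathcal X$-valued random variable independent of $(\varepsilon_i)_{i\ge2}$. The Markov chain is $X_n=F(X_{n-1},\varepsilon_n)$ for $n\ge2$, where $F:\mathcal X\times\mathcal Y\to\mathcal X$ is measurable and satisfies, for some $\rho\in[0,1)$ and $C>0$, $\mathbb E[d(F(x,\varepsilon_1),F(x',\varepsilon_1))]\le\rho\,d(x,x')$ for all $x,x'\in\mathcal X$, and $d(F(x,y),F(x,y'))\le C\,\delta(y,y')$ for all $x\in\mathcal X$, $y,y'\in\mathcal Y$. Fix $n\ge1$ and $f:\mathcal X^n\to\mathbb R$ with $|f(x_1,\ldots,x_n)-f(x_1',\ldots,x_n')|\le d(x_1,x_1')+\cdots+d(x_n,x_n')$, and let $S_n=f(X_1,\ldots,X_n)-\mathbb E[f(X_1,\ldots,X_n)]$. Let $P_{X_1}$ be the law of $X_1$, $P_\varepsilon$ the common law of the $\varepsilon_k$'s, $G_{X_1}(x)=\int d(x,x')P_{X_1}(dx')$, $G_\varepsilon(y)=\int C\,\delta(y,y')P_\varepsilon(dy')$; $G_\varepsilon(\varepsilon)$ denotes a random variable distributed as $G_\varepsilon(\varepsilon_k)$. For $k\in\mathbb N$, $K_k(\rho)=1+\rho+\cdots+\rho^k$. For a real random variable $Z$ and $p\ge1$, the weak moment is $\|Z\|_{w,p}^p=\sup_{x>0}x^p\,\mathbb P(|Z|>x)$.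 Statements with $\pm$ hold for each of the two signs. *)

(* Defs.v *)
From HB Require Import structures.
From mathcomp Require Import all_boot all_order all_algebra finmap.
From mathcomp Require Import all_classical all_reals all_analysis.

Set Implicit Arguments.
Unset Strict Implicit.
Unset Printing Implicit Defensive.

Import Order.TTheory GRing.Theory Num.Theory.
Import numFieldTopology.Exports.

Local Open Scope classical_set_scope.
Local Open Scope ring_scope.

(* A complete space of the library is pointed, hence nonempty; this is no
   restriction for a space that carries a random variable. *)
#[short(type="completeMetricType")]
HB.structure Definition CompleteMetric (R : numDomainType) :=
  {T of Complete T & Metric R T}.

Definition separable_space (T : topologicalType) : Prop :=
  exists2 D : set T, countable D & dense D.

Notation borel T := (g_sigma_algebraType (@open T)).

Section independence.
Local Open Scope ereal_scope.
Context d d1 d2 (Omega : measurableType d) (T1 : measurableType d1)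
  (T2 : measurableType d2) (R : realType) (P : probability Omega R).

(* For a collection I of indices which may be infinite: the product rule over
   all finite subcollections. *)
Definition mutually_independent (I : set nat) (Z : nat -> Omega -> T2) : Prop :=
  forall (J : {fset nat}) (B : nat -> set T2),
    [set` J] `<=` I -> (forall i, measurable (B i)) ->
    P (\bigcap_(i in [set` J]) (Z i @^-1` B i)) =
    \prod_(i <- J) P (Z i @^-1` B i).

Definition identically_distributed (I : set nat)
    (Z : nat -> Omega -> T2) : Prop :=
  forall i j B, I i -> I j -> measurable B ->
    P (Z i @^-1` B) = P (Z j @^-1` B).

Definition sigma_family (I : set nat) (Z : nat -> Omega -> T2) :
    set (set Omega) :=
  <<s \bigcup_(i in I) preimage_set_system setT (Z i) measurable >>.

Definition independent_of_family (X : Omega -> T1)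
    (I : set nat) (Z : nat -> Omega -> T2) : Prop :=
  forall A B, measurable A -> sigma_family I Z B ->
    P ((X @^-1` A) `&` B) = P (X @^-1` A) * P B.

End independence.

Section moments.
Local Open Scope ereal_scope.
Context d (Omega : measurableType d) (R : realType) (P : probability Omega R).

Definition weak_moment (Z : Omega -> \bar R) (p : R) : \bar R :=
  ereal_sup [set (x `^ p)%:E * P [set w | x%:E < `|Z w|] | x in [set x | (0 < x)%R]].

Definition centered (Z : Omega -> R) (w : Omega) : R := (Z w - fine 'E_P[Z])%R.

(* The mean distance from x to a point of law mu. It is extended real valued:
   without moment assumptions it may be infinite. *)
Definition mean_dist (T : completeMetricType R) (mu : set (borel T) -> \bar R)
    (x : T) : \bar R :=
  \int[mu]_x' (mdist x x')%:E.

End moments.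

Definition geosum (R : realType) (rho : R) (k : nat) : R :=
  \sum_(i < k.+1) rho ^+ i.

(* At x = n the second factor is (n / 0) `^ 0, which is 1 since a `^ 0 = 1 for
   every a: this is the convention (+oo)^0 = 1. *)
Definition Hfun (R : realType) (n : nat) (x v : R) : R :=
  if x <= n%:R then
    ((v ^+ 2 / (x + v ^+ 2)) `^ (x + v ^+ 2) *
     (n%:R / (n%:R - x)) `^ (n%:R - x)) `^ (n%:R / (n%:R + v ^+ 2))
  else 0.

(* Main.v *)
Require Import Defs.
From HB Require Import structures.
From mathcomp Require Import all_boot all_order all_algebra finmap.
From mathcomp Require Import all_classical all_reals all_analysis.
From mathcomp Require Import measurable_realfun.
From mathcomp Require Import zify ring lra.

Set Implicit Arguments.
Unset Strict Implicit.
Unset Printing Implicit Defensive.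

Import Order.TTheory GRing.Theory Num.Theory.
Import numFieldTopology.Exports.
Local Open Scope classical_set_scope.
Local Open Scope ring_scope.

(** The centred functional is a sum of martingale increments, to which a
    truncated Hoeffding-Bennett argument applies.

    Write g_k for the mean of f(X_1, ..., X_n) given X_1, ..., X_k
    ([remaining_mean]): g_n = f, and g_(k-1) averages g_k over the k-th noise
    variable. Contraction in mean makes g_k Lipschitz in its last coordinate
    with constant K_(n-k), because one step of the chain turns a constant K_j
    into 1 + rho K_j = K_(j+1) ([remaining_mean_lipschitz]). Hence the increment
    D_k = g_k - g_(k-1) deviates from its conditional mean 0 by at most
    K_(n-k) G_eps(eps_k), and D_1 by at most K_(n-1) G_X1(X_1)
    ([incrementS_le], [increment0_le]); these dominating variables carry the
    moment hypotheses.

    Put b = y K_(n-1) and truncate each D_k at b. If no D_k exceeds b, truncation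
    changes nothing; if some D_k does, then G_X1(X_1) > y or G_eps(eps_k) > y,
    and the weak moments bound the total probability of this by A(p) / y^p
    ([truncation_tail], [weak_moment_tail]).

    For the truncated sum, the exponential e^(lam z) is dominated on z <= 1 by
    the parabola which equals it at z = 1 and is tangent to it at z = -t
    ([parabola_majorant]). So a variable with mean 0 and second moment at most
    s, truncated at 1, has an exponential moment which is at most an affine
    function of s, equal at s = t to that of the law on {-t, 1} with mean 0.
    Taking for t the average v^2 / n of the n variance bounds and using
    1 + u <= e^u, the product of the n bounds collapses to the n-th power of the
    value at t ([truncated_mgf_le], [increments_mgf]). Optimising Chernoff's
    bound over lam yields exactly H_n ([chernoff_exponent]).

    Conditional expectations are replaced by Fubini's theorem: the past is the
    sample space itself with a coarser sigma-algebra, the identity is a random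
    variable with values in it, and its joint law with the next noise variable
    is a product measure ([history_indep], [ge0_freezing]). Measurability of
    the g_k follows from their Lipschitz continuity, since a Lipschitz function
    on a separable space is a countable infimum of functions of the distances
    to the points of a dense sequence
    ([measurable_lipschitz]). *)

(** * The exponential and its quadratic majorant *)

Section calculus.
Variable R : realType.
Implicit Types a b lam t s u x z : R.

Lemma ge0_of_derive_ge0 (h h' : R -> R) :
  (forall x : R, is_derive x 1 h (h' x)) -> (forall x, 0 <= x -> 0 <= h' x) ->
  h 0 = 0 -> forall x, 0 <= x -> 0 <= h x.
Proof.
move=> dh h'0 h0 x x0; rewrite -h0.
have derh y : derivable h y 1 by have [] := dh y.
apply: (@ger0_derive1_le_cc _ h 0 x) => //.
- move=> y; rewrite in_itv/= => /andP[y0 _].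
  by rewrite derive1E (@derive_val _ _ _ _ _ _ _ (dh y)) h'0 ?ltW.
- apply: derivable_within_continuous => y _; exact: derh.
- by rewrite in_itv/= lexx.
- by rewrite in_itv/= lexx andbT.
Qed.

(** The derivative in [a] is s^2 (e^a - e^(sa)), which is nonnegative whatever
    the sign of s: multiplying by s covers s < 0 and 0 <= s <= 1 at once. *)
Lemma expR_scale_slope_ge0 s a : s <= 1 -> 0 <= a ->
  0 <= s * (s * (expR a - 1) - (expR (s * a) - 1)).
Proof.
move=> s1 a0.
pose h : R -> R :=
  s \*: ((s \*: (expR - cst 1)) - ((expR \o (s \*: @id R)) - cst 1)).
have -> : s * (s * (expR a - 1) - (expR (s * a) - 1)) = h a.
  by rewrite /h /= !fctE /cst /= /GRing.scale/=.
refine (@ge0_of_derive_ge0 h (fun x => s ^+ 2 * (expR x - expR (s * x))) _ _ _ _ a0).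
- move=> y; apply: is_derive_eq.
  by rewrite /= /GRing.scale/=; lra.
- move=> y y0; rewrite mulr_ge0 ?sqr_ge0// subr_ge0 ler_expR; nra.
- rewrite /h /= !fctE /cst /= /GRing.scale/= mulr0 expR0; lra.
Qed.

Lemma expR_scale_remainder_le s a : s <= 1 -> 0 <= a ->
  expR (s * a) - 1 - s * a <= s ^+ 2 * (expR a - 1 - a).
Proof.
move=> s1 a0; rewrite -subr_ge0.
pose h : R -> R := (s ^+ 2 \*: (expR - cst 1 - id)) -
  ((expR \o (s \*: @id R)) - cst 1 - (s \*: @id R)).
have -> : s ^+ 2 * (expR a - 1 - a) - (expR (s * a) - 1 - s * a) = h a.
  by rewrite /h /= !fctE /cst /= /GRing.scale/=.
refine (@ge0_of_derive_ge0 h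
    (fun x => s * (s * (expR x - 1) - (expR (s * x) - 1))) _ _ _ _ a0).
- move=> y; apply: is_derive_eq.
  by rewrite /= /GRing.scale/=; lra.
- by move=> y y0; exact: expR_scale_slope_ge0.
- rewrite /h /= !fctE /cst /= /GRing.scale/= mulr0 expR0; lra.
Qed.

(** Equivalently, (e^u - 1 - u) / u^2 is nondecreasing; dividing u by a turns
    this into the scaling inequality above, without a division by u. *)
Lemma expR_le_parabola a u : 0 < a -> u <= a ->
  expR u <= 1 + u + (expR a - 1 - a) / a ^+ 2 * u ^+ 2.
Proof.
move=> a0 ua.
have -> : u = (u / a) * a by rewrite divfK// gt_eqF.
have := @expR_scale_remainder_le (u / a) a _ (ltW a0).
rewrite ler_pdivrMr// mul1r => /(_ ua).
set s := u / a => H; rewrite [(s * a) ^+ 2]exprMn.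
have E : (expR a - 1 - a) / a ^+ 2 * (s ^+ 2 * a ^+ 2) =
    s ^+ 2 * (expR a - 1 - a) by field; rewrite gt_eqF.
rewrite E; lra.
Qed.

(** The exponential moment at [lam] of the law on {- t, 1} with mean 0, whose
    variance is t. *)
Definition two_point_mgf lam t := (expR (- (lam * t)) + t * expR lam) / (1 + t).

(** The parabola agrees with e^(lam z) at the two atoms 1 and - t of the extremal
    law, and the tangency at - t is what makes it a majorant on z <= 1. Its mean
    under a law with mean 0 and second moment s is [q0 + q2 * s], an affine
    function of s; [0 <= q1] extends this bound to negative means. *)
Lemma parabola_majorant lam t : 0 < lam -> 0 < t ->
  exists q : R * R * R, let: (q0, q1, q2) := q in
  [/\ 0 <= q1, 0 <= q2, q0 + q2 * t = two_point_mgf lam t &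
      forall z, z <= 1 -> expR (lam * z) <= q0 + q1 * z + q2 * z ^+ 2].
Proof.
move=> l0 t0; pose a := lam * (1 + t); pose c := (expR a - 1 - a) / a ^+ 2.
have a0 : 0 < a by rewrite mulr_gt0// addr_gt0.
have c0 : 0 <= c.
  rewrite divr_ge0 ?sqr_ge0//.
  have := expR_ge1Dx a; lra.
pose e := expR (- (lam * t)).
have e0 : 0 <= e := expR_ge0 _.
exists (e * (1 + lam * t + c * lam ^+ 2 * t ^+ 2),
  e * (lam + 2 * c * lam ^+ 2 * t), e * (c * lam ^+ 2)) => /=; split.
- apply: mulr_ge0 => //; apply: addr_ge0; first exact: ltW.
  by rewrite mulr_ge0 ?(ltW t0)// mulr_ge0 ?sqr_ge0// mulr_ge0.
- by apply: mulr_ge0 => //; apply: mulr_ge0 => //; exact: sqr_ge0.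
- rewrite /two_point_mgf.
  have -> : expR lam = e * expR a.
    by rewrite /e /a -expRD; congr expR; ring.
  rewrite -/e /c /a; field; rewrite !gt_eqF// addr_gt0//.
- move=> z z1.
  have -> : expR (lam * z) = e * expR (lam * (z + t)).
    by rewrite /e -expRD; congr expR; ring.
  have -> : e * (1 + lam * t + c * lam ^+ 2 * t ^+ 2) +
    e * (lam + 2 * c * lam ^+ 2 * t) * z + e * (c * lam ^+ 2) * z ^+ 2 =
    e * (1 + lam * (z + t) + c * (lam * (z + t)) ^+ 2) by ring.
  rewrite ler_wpM2l// expR_le_parabola// ler_pM2l//; lra.
Qed.

(** [Hfun] is the Chernoff bound at the minimiser over [lam]. With s = x / n and
    t = v^2 / n, the minimiser solves e^(lam (1 + t)) = (s + t) / (t (1 - s)),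
    which simplifies the two-point moment to e^(- lam t) / (1 - s). *)
Lemma chernoff_exponent (n : nat) x v : 0 < x -> x < n%:R -> 0 < v ->
  exists2 lam, 0 < lam &
    expR (- (lam * x)) * two_point_mgf lam (v ^+ 2 / n%:R) ^+ n = Hfun n x v.
Proof.
move=> x0 xn v0; have n0 : 0 < n%:R :> R := lt_trans x0 xn.
pose t := v ^+ 2 / n%:R; pose s := x / n%:R.
have t0 : 0 < t by rewrite divr_gt0// exprn_gt0.
have s0 : 0 < s by rewrite divr_gt0.
have s1 : 0 < 1 - s by rewrite subr_gt0 ltr_pdivrMr// mul1r.
have st0 : 0 < s + t by rewrite addr_gt0.
pose p := (s + t) / t; pose q := (1 - s)^-1.
have p0 : 0 < p by rewrite divr_gt0.
have q0 : 0 < q by rewrite invr_gt0.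
pose lam := (ln p + ln q) / (1 + t).
have t1 : 0 < 1 + t by rewrite addr_gt0.
have lp : 0 < ln p by rewrite ln_gt0// ltr_pdivlMr// mul1r; lra.
have lq : 0 < ln q by rewrite ln_gt0// invf_gt1//; lra.
exists lam; first by rewrite divr_gt0// addr_gt0.
have -> : two_point_mgf lam t = expR (- (lam * t) + ln q).
  rewrite /two_point_mgf.
  have -> : expR lam = expR (- (lam * t)) * (p * q).
    rewrite -{1}(lnK p0) -{1}(lnK q0) -!expRD; congr expR; rewrite /lam.
    by field; rewrite gt_eqF.
  rewrite expRD (lnK q0) /p /q; field; rewrite !gt_eqF//.
rewrite -expRM_natl -expRD /Hfun (ltW xn).
have -> : v ^+ 2 / (x + v ^+ 2) = expR (- ln p).
  rewrite expRN (lnK p0) /p /s /t; field.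
  by rewrite !gt_eqF ?addr_gt0 ?exprn_gt0.
have -> : n%:R / (n%:R - x) = expR (ln q).
  by rewrite (lnK q0) /q /s; field; rewrite !gt_eqF// subr_gt0.
rewrite -!expRM -expRD -expRM; congr expR; rewrite /lam.
have -> : x = n%:R * s by rewrite /s mulrC divfK// gt_eqF.
have -> : v ^+ 2 = n%:R * t by rewrite /t mulrC divfK// gt_eqF.
field; rewrite !gt_eqF// -mulr_natr; nra.
Qed.

Lemma Hfun_ge0 (n : nat) x v : 0 <= Hfun n x v.
Proof. by rewrite /Hfun; case: ifP => // _; exact: powR_ge0. Qed.

End calculus.

(** * Exponential moments of truncated centred variables *)

Section truncated_mgf.
Variable R : realType.

Lemma two_point_mgf_gt0 (lam t : R) : 0 < t -> 0 < two_point_mgf lam t.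
Proof.
by move=> t0; rewrite divr_gt0 ?addr_gt0 ?mulr_gt0 ?expR_gt0.
Qed.

(** The factor [expR (c * (s - t))] comes from 1 + u <= e^u applied to the affine
    bound q0 + q2 s. The constant [c] is the same for all laws, so that when
    several variance bounds [s] average to [t] these factors cancel. Truncation
    only decreases [h] and its square, so the parabola may be evaluated at [h]
    instead, its coefficients q1 and q2 being nonnegative. *)
Lemma truncated_mgf_le (lam t : R) : 0 < lam -> 0 < t ->
  exists c : R, forall d (T : measurableType d) (mu : probability T R)
      (h : T -> R) (s : R),
    mu.-integrable setT (EFin \o h) -> (\int[mu]_y (h y)%:E = 0)%E ->
    (\int[mu]_y (h y ^+ 2)%:E <= s%:E)%E ->
    (\int[mu]_y (expR (lam * Num.min (h y) 1))%:E <=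
       (two_point_mgf lam t * expR (c * (s - t)))%:E)%E.
Proof.
move=> l0 t0; have [[[q0 q1] q2] [q1_ge0 q2_ge0 qB qmaj]] := parabola_majorant l0 t0.
have B0 := two_point_mgf_gt0 lam t0; set B := two_point_mgf lam t in qB B0 *.
exists (q2 / B) => d T mu h s ih h0 h2.
have mh : measurable_fun setT h by exact/measurable_EFinP/(measurable_int mu ih).
have ih2 : mu.-integrable setT (EFin \o (fun y => h y ^+ 2)).
  apply/integrableP; split; first by apply/measurable_EFinP; exact: measurable_funX.
  under eq_integral do rewrite /= ger0_norm ?sqr_ge0//.
  by rewrite (le_lt_trans h2)// ltry.
have icst : mu.-integrable setT (EFin \o cst q0).
  exact: finite_measure_integrable_cst.
apply: (@le_trans _ _ (\int[mu]_y (q0 + q1 * h y + q2 * h y ^+ 2)%:E)%E).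
  apply: ge0_le_integral => //.
  - apply/measurable_EFinP; apply: measurableT_comp => //.
    by apply: measurable_funM => //; exact: measurable_minr.
  - apply/measurable_EFinP; apply: measurable_funD.
      by apply: measurable_funD => //; exact: measurable_funM.
    by apply: measurable_funM => //; exact: measurable_funX.
  - move=> y _; rewrite lee_fin; have [hy1|hy1] := leP (h y) 1.
      exact: qmaj.
    apply: (le_trans (qmaj 1 (lexx _))); rewrite lerD//.
      by rewrite lerD// ler_wpM2l// ltW.
    by rewrite ler_wpM2l// lerXn2r// ?nnegrE ?ltW// (lt_trans _ hy1).
have -> : (\int[mu]_y (q0 + q1 * h y + q2 * h y ^+ 2)%:E =
   q0%:E + q1%:E * \int[mu]_y (h y)%:E + q2%:E * \int[mu]_y (h y ^+ 2)%:E)%E.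
  under eq_integral do rewrite !EFinD !EFinM.
  rewrite integralD//=; last 2 first.
  - by apply: integrableD => //=; exact: integrableZl.
  - exact: integrableZl.
  rewrite integralD//=; last exact: integrableZl.
  rewrite !integralZl//; congr (_ + _ + _)%E.
  by rewrite integral_cst//= probability_setT mule1.
rewrite h0 mule0 adde0.
apply: (@le_trans _ _ (q0%:E + q2%:E * s%:E)%E).
  by rewrite leeD2l// lee_wpmul2l// lee_fin.
rewrite -EFinM -EFinD lee_fin.
have -> : q0 + q2 * s = B * (1 + q2 / B * (s - t)).
  by rewrite -qB; field; rewrite qB gt_eqF.
by rewrite ler_wpM2l ?expR_ge1Dx// ltW.
Qed.

End truncated_mgf.

(** * Measurability of Lipschitz functions *)

Section lipschitz_measurability.
Context (R : realType) (E : completeMetricType R).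
Hypothesis sepE : separable_space E.

Lemma open_metric_ball (x : E) (r : R) : open (ball x r).
Proof.
rewrite openE => y; rewrite ballEmdist/= => yr; apply/nbhs_ballP.
exists (r - mdist x y); first by rewrite /= subr_gt0.
move=> z; rewrite !ballEmdist/= => yz.
by rewrite (le_lt_trans (metric_triangle _ y _))// -ltrBrDl.
Qed.

Lemma dense_sequence :
  exists q : nat -> E, forall (x : E) (r : R), 0 < r -> exists j, mdist x (q j) < r.
Proof.
have [D /countable_injP[h hinj] Ddense] := sepE.
exists (fun j => get [set x | D x /\ h x = j]) => x r r0.
have [|y [xy Dy]] := Ddense (ball x r) _ (open_metric_ball x r).
  by exists x; exact: ballxx.
exists (h y); case: xgetP => [z _ [Dz hz]|]; last by move/(_ y); case.
have -> : z = y by apply: hinj; rewrite ?inE.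
by move: xy; rewrite ballEmdist.
Qed.

Lemma measurable_mdist d (T : measurableType d) (Z : T -> borel E) (x : E) :
  measurable_fun setT Z -> measurable_fun setT (fun t => mdist x (Z t)).
Proof.
move=> mZ mT; apply: (measurability _ (RGenInftyO.measurableE R)) => //.
move=> _ [_ [r ->] <-]; rewrite setTI.
have -> : (fun t => mdist x (Z t)) @^-1` [set` `]-oo, r[] = Z @^-1` (ball x r).
  by apply/seteqP; split => t /=; rewrite ballEmdist in_itv.
rewrite -[X in measurable X]setTI; apply: mZ => //.
by apply: sub_sigma_algebra; exact: open_metric_ball.
Qed.

(** By density, g is the infimum over the sequences [u s] of dense points of
    g(u s) + sum_i L_i d(u s i, .), so that a strict sublevel set is a countable
    union. Each term only involves distances to fixed points, which are Borel. *)
Lemma measurable_lipschitz d (T : measurableType d) (Z : nat -> T -> borel E)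
    (g : (nat -> E) -> R) (L : nat -> R) (k : nat) :
  (forall i, (i < k)%N -> measurable_fun setT (Z i)) ->
  (forall i, 0 <= L i) ->
  (forall u u', `|g u - g u'| <= \sum_(i < k) L i * mdist (u i) (u' i)) ->
  measurable_fun setT (fun t => g (fun i => Z i t)).
Proof.
move=> mZ L0 gL mT; have [q qdense] := dense_sequence.
pose u (s : seq nat) i : E := q (nth 0%N s i).
pose approx s t := g (u s) + \sum_(i < k) L i * mdist (u s i) (Z i t).
apply: (measurability _ (RGenInftyO.measurableE R)) => //.
move=> _ [_ [a ->] <-]; rewrite setTI.
have -> : (fun t => g (Z ^~ t)) @^-1` [set` `]-oo, a[] =
    \bigcup_s (approx s @^-1` [set` `]-oo, a[]).
  apply/seteqP; split => t /=; last first.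
    move=> [s _] /=; rewrite !in_itv/= /approx; apply: le_lt_trans.
    by rewrite -lerBlDl (le_trans (ler_norm _))// (le_trans (gL _ _))//
       ler_sum// => i _; rewrite metric_sym.
  rewrite in_itv/= => gta.
  pose e := a - g (Z ^~ t); pose S := \sum_(i < k) L i.
  have e0 : 0 < e by rewrite subr_gt0.
  have S0 : 0 <= S by rewrite sumr_ge0.
  (* The distances are counted twice: once in the approximant itself, once in
     the Lipschitz error of g; the summand 1 covers S = 0. *)
  pose r := e / (S + S + 1).
  have SS0 : 0 < S + S + 1 by rewrite ltr_wpDl// addr_ge0.
  have r0 : 0 < r by rewrite divr_gt0.
  have /choice[j jr] := fun i => qdense (Z i t) r r0.
  exists (mkseq j k) => //=; rewrite in_itv/= /approx.
  have sum_le : \sum_(i < k) L i * mdist (u (mkseq j k) i) (Z i t) <= S * r.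
    rewrite mulr_suml ler_sum// => i _; rewrite ler_wpM2l//.
    by rewrite /u nth_mkseq// metric_sym ltW.
  have g_le : g (u (mkseq j k)) <= g (Z ^~ t) + S * r.
    rewrite -lerBlDl (le_trans (ler_norm _))// (le_trans (gL _ _))//.
  have Sr : S * r + S * r < e.
    rewrite -mulrDl /r mulrA ltr_pdivrMr// mulrC ltr_pM2l//; lra.
  move: Sr g_le sum_le; rewrite /e; lra.
apply: countable_bigcupT_measurable; first exact: countableP.
move=> s; rewrite -[X in measurable X]setTI.
suff : measurable_fun setT (approx s) by apply => //; exact: measurable_itv.
apply: measurable_funD => //.
have -> : (fun t => \sum_(i < k) L i * mdist (u s i) (Z i t)) =
    (fun t => \sum_(i <- enum 'I_k) L i * mdist (u s i) (Z i t)).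
  by apply/funext => t; rewrite big_enum.
apply: measurable_sum => i.
by apply: measurable_funM => //; exact/measurable_mdist/mZ.
Qed.

End lipschitz_measurability.

(** * Freezing an independent past *)

Section random_variable_facts.
Context d d1 (Omega : measurableType d) (T : measurableType d1) (R : realType)
  (P : probability Omega R) (Z : {RV P >-> T}).

Lemma preimage_measurable (A : set T) : measurable A -> measurable (Z @^-1` A).
Proof. by move=> mA; rewrite -[X in measurable X]setTI; exact: measurable_funP. Qed.

Lemma integrable_comp (h : T -> R) :
  (distribution P Z).-integrable setT (EFin \o h) ->
  P.-integrable setT (EFin \o (h \o Z)).
Proof.
move=> /integrableP[mh ih]; apply/integrableP; split.
  by apply: (measurableT_comp mh).
by move: ih; rewrite ge0_integral_distribution//; exact: measurableT_comp.
Qed.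

End random_variable_facts.

Section freezing.
Local Open Scope ereal_scope.
Context d d1 d2 (Omega : measurableType d) (T : measurableType d1)
  (Y : measurableType d2) (R : realType) (P : probability Omega R)
  (U : {RV P >-> T}) (V : {RV P >-> Y}).
Hypothesis indepUV : forall A B, measurable A -> measurable B ->
  P (U @^-1` A `&` V @^-1` B) = P (U @^-1` A) * P (V @^-1` B).

Let W (w : Omega) : T * Y := (U w, V w).

Let mW : measurable_fun setT W.
Proof. exact: measurable_fun_pair. Qed.

HB.instance Definition _ := isMeasurableFun.Build _ _ _ _ W mW.

Lemma joint_distribution (A : set (T * Y)) : measurable A ->
  (distribution P U \x distribution P V) A = distribution P W A.
Proof.
by apply: product_measure_unique => B C mB mC; rewrite -indepUV.
Qed.

(** Conditionally on [U], the variable [V] keeps its law: the mean is computed by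
    freezing [U] and integrating over [V] alone. *)
Lemma ge0_freezing (h : T * Y -> \bar R) :
  measurable_fun setT h -> (forall z, 0 <= h z) ->
  \int[P]_w h (U w, V w) = \int[P]_w \int[distribution P V]_y h (U w, y).
Proof.
move=> mh h0.
transitivity (\int[distribution P W]_z h z).
  by rewrite ge0_integral_distribution.
rewrite (eq_measure_integral (distribution P U \x distribution P V)); last first.
  by move=> A mA _; apply/esym; exact: joint_distribution.
rewrite fubini_tonelli1// ge0_integral_distribution//.
- exact: measurable_fun_fubini_tonelli_F.
- by move=> x; exact: integral_ge0.
Qed.

Lemma freezing_mean0 (h : T * Y -> R) :
  measurable_fun setT h -> P.-integrable setT (fun w => (h (U w, V w))%:E) ->
  (forall u, \int[distribution P V]_y (h (u, y))%:E = 0) ->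
  \int[P]_w (h (U w, V w))%:E = 0.
Proof.
move=> mh ih h0.
have mEh : measurable_fun setT (EFin \o h) by exact/measurable_EFinP.
transitivity (\int[distribution P W]_z (h z)%:E).
  by rewrite integral_distribution.
rewrite (eq_measure_integral (distribution P U \x distribution P V)); last first.
  by move=> A mA _; apply/esym; exact: joint_distribution.
rewrite -integral12_prod_meas1.
  by apply: integral0_eq => x _; rewrite /fubini_F h0.
apply/integrableP; split => //.
rewrite (eq_measure_integral (distribution P W)); last first.
  by move=> A mA _; exact: joint_distribution.
have /integrableP[_] := ih; rewrite ge0_integral_distribution//.
exact: measurableT_comp.
Qed.

End freezing.

Section history.
Local Open Scope ereal_scope.
Context d d1 d2 (Omega : measurableType d) (T1 : measurableType d1)
  (T2 : measurableType d2) (R : realType) (P : probability Omega R)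
  (X : {RV P >-> T1}) (eps : nat -> {RV P >-> T2}).

(** The rectangles generating the sigma-algebra of X, eps_2, ..., eps_k; they
    are stable under intersection, so that independence from them extends to
    the whole sigma-algebra. *)
Definition history (k : nat) : set (set Omega) :=
  [set A | exists A0 (B : nat -> set T2), [/\ measurable A0,
    forall i, measurable (B i) & A = X @^-1` A0 `&`
     \bigcap_(i in [set i | (2 <= i <= k)%N]) (eps i @^-1` B i)]].

Lemma history_measurable k : history k `<=` measurable.
Proof.
move=> _ [A0 [B [mA0 mB ->]]]; apply: measurableI; first exact: preimage_measurable.
by apply: bigcap_measurableType => i _; exact: preimage_measurable.
Qed.

Lemma history_setI k : setI_closed (history k).
Proof.
move=> _ _ [A [B [mA mB ->]]] [A' [B' [mA' mB' ->]]].
exists (A `&` A'), (fun i => B i `&` B' i); split.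
- exact: measurableI.
- by move=> i; exact: measurableI.
- rewrite preimage_setI setIACA; congr (_ `&` _).
  by rewrite -bigcapI; apply: eq_bigcapr => i _; rewrite preimage_setI.
Qed.

Lemma history_setT k : history k setT.
Proof.
exists setT, (fun=> setT); split => //; rewrite preimage_setT setTI.
by apply/esym; rewrite -subTset => w _ i _.
Qed.

Lemma history_subset k : <<s history k >> `<=` measurable.
Proof.
apply: smallest_sub; first exact: sigma_algebra_measurable.
exact: history_measurable.
Qed.

Lemma measurable_init_history k :
  measurable_fun setT (X : g_sigma_algebraType (history k) -> T1).
Proof.
move=> _ A mA; rewrite setTI; apply: sub_sigma_algebra.
exists A, (fun=> setT); split => //; rewrite -[LHS]setIT; congr (_ `&` _).
by apply/esym; rewrite -subTset => w _ i _.
Qed.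

Lemma measurable_innov_history k i : (2 <= i <= k)%N ->
  measurable_fun setT (eps i : g_sigma_algebraType (history k) -> T2).
Proof.
move=> ik _ B mB; rewrite setTI; apply: sub_sigma_algebra.
exists setT, (fun j => if j == i then B else setT); split => //.
  by move=> j; case: ifP.
rewrite preimage_setT setTI; apply/seteqP; split => [w Bw j _ /=|w /(_ i ik)/=].
  by case: eqP => // ->.
by rewrite eqxx.
Qed.

Lemma measurable_id_history k :
  measurable_fun setT (id : Omega -> g_sigma_algebraType (history k)).
Proof. by move=> _ A /history_subset mA; rewrite setTI. Qed.

Hypothesis eps_indep : mutually_independent P [set i | (1 <= i)%N] (fun i => eps i).
Hypothesis X_indep : independent_of_family P X [set i | (2 <= i)%N] (fun i => eps i).

Let idx (k : nat) : {fset nat} := [fset i in iota 2 k.-1]%fset.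

Let idxE k : (1 <= k)%N -> [set` idx k] = [set i | (2 <= i <= k)%N].
Proof.
move=> k1; apply/seteqP; split => i /=; rewrite in_fset/= mem_iota.
all: by case: k k1 => // k _ /=; lia.
Qed.

Let sigma_bigcap (J : {fset nat}) (B : nat -> set T2) :
  [set` J] `<=` [set i | (2 <= i)%N] -> (forall i, measurable (B i)) ->
  sigma_family [set i | (2 <= i)%N] (fun i => eps i)
    (\bigcap_(i in [set` J]) (eps i @^-1` B i)).
Proof.
move=> J2 mB.
pose S := \bigcup_(i in [set i | (2 <= i)%N])
  preimage_set_system setT (eps i) measurable.
apply: (@fin_bigcap_measurable _ (g_sigma_algebraType S)) => //.
move=> i /J2 i2; apply: sub_sigma_algebra; exists i => //.
by exists (B i) => //; rewrite setTI.
Qed.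

(** On rectangles the product rule follows by removing X first and then
    eps_(k+1). Both sides are finite measures in [A], namely the restriction of
    P to an event and a multiple of P, hence they agree on the generated
    sigma-algebra. *)
Lemma history_indep k (A : set Omega) (C : set T2) : (1 <= k)%N ->
  <<s history k >> A -> measurable C ->
  P (A `&` eps k.+1 @^-1` C) = P A * P (eps k.+1 @^-1` C).
Proof.
move=> k1 hA mC; set N := eps k.+1 @^-1` C.
have mN : measurable N by exact: preimage_measurable.
have PN : P N = (fine (P N))%:E by rewrite fineK// fin_num_measure.
have PN0 : (0 <= fine (P N))%R by rewrite fine_ge0.
pose m1 := mrestr P mN; pose m2 := mscale (NngNum PN0) P.
rewrite muleC PN; suff : m1 A = m2 A by [].
apply: (g_sigma_algebra_measure_unique (history k) _ (fun=> setT)) => //.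
- exact: history_measurable.
- by move=> _; exact: history_setT.
- by rewrite bigcup_const.
- exact: history_setI.
- move=> _ [A0 [B [mA0 mB ->]]]; set D := \bigcap_(i in _) _.
  change (P (X @^-1` A0 `&` D `&` N) = (fine (P N))%:E * P (X @^-1` A0 `&` D)).
  rewrite -PN -setIA /D {D}.
  have -> : \bigcap_(i in [set i | (2 <= i <= k)%N]) (eps i @^-1` B i) `&` N =
      \bigcap_(i in [set` (k.+1 |` idx k)%fset])
         (eps i @^-1` (if i == k.+1 then C else B i)).
    rewrite -idxE//; apply/seteqP; split => w.
      move=> [wB wN] i /=; rewrite in_fset1U; case: eqP => [-> //|_ /= ik].
      exact: wB.
    move=> H; split; last first.
      by have := H k.+1; rewrite /= in_fset1U eqxx; apply.
    move=> i /= ik; have := H i; rewrite /= in_fset1U ik orbT => /(_ isT).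
    suff /negbTE -> : i != k.+1 by [].
    have : [set` idx k] i by [].
    by rewrite idxE// => /= /andP[_]; rewrite neq_ltn ltnS => ->.
  have idx2 i : (i \in idx k) -> (2 <= i <= k)%N.
    by move=> ik; have : [set` idx k] i by []; rewrite idxE.
  have mB' i : measurable (if i == k.+1 then C else B i) by case: ifP.
  rewrite X_indep//; last first.
    apply: sigma_bigcap => // i /=; rewrite in_fset1U => /orP[/eqP ->|/idx2 /andP[]//].
    by rewrite ltnS.
  rewrite -idxE// X_indep//; last by apply: sigma_bigcap => // i /idx2 /andP[].
  rewrite eps_indep//; last first.
    by move=> i /=; rewrite in_fset1U => /orP[/eqP ->//|/idx2 /andP[/ltnW]].
  rewrite eps_indep//; last by move=> i /idx2 /andP[/ltnW].
  rewrite big_fsetU1/=; last by apply/negP => /idx2; rewrite ltnn andbF.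
  rewrite eqxx -/N.
  rewrite [in LHS](eq_big_seq (fun i => P (eps i @^-1` B i))); last first.
    move=> i /idx2 /andP[_ ik]; suff /negbTE -> : i != k.+1 by [].
    by rewrite neq_ltn ltnS ik.
  by rewrite muleCA.
- move=> _; apply: (@le_lt_trans _ _ 1); last exact: ltry.
  by apply: probability_le1; apply: measurableI.
Qed.

End history.

(** * Tails of truncated sums *)

Section truncated_sums.
Local Open Scope ereal_scope.
Context d (Omega : measurableType d) (R : realType) (P : probability Omega R).

Lemma measurable_truncated_sum d' (T : measurableType d') (n : nat)
    (D : nat -> T -> R) (b : R) :
  (forall k, (k < n)%N -> measurable_fun setT (D k)) ->
  measurable_fun setT (fun w => \sum_(k < n) Num.min (D k w / b) 1)%R.
Proof.
move=> mD.
have -> : (fun w => \sum_(k < n) Num.min (D k w / b) 1)%R =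
    (fun w => \sum_(k <- enum 'I_n) Num.min (D k w / b) 1)%R.
  by apply/funext => w; rewrite big_enum.
apply: measurable_sum => k; apply: measurable_minr => //.
by apply: measurable_funM => //; exact: mD.
Qed.

(** If x / b >= n the event is empty, since each truncated term is at most 1;
    this covers the indicator in [Hfun] and its boundary value x / b = n, where
    the minimiser over [lam] of [chernoff_exponent] escapes to infinity. *)
Lemma truncated_sum_tail (n : nat) (D : nat -> Omega -> R) (b x v : R) :
  (forall k, (k < n)%N -> measurable_fun setT (D k)) ->
  (0 < b)%R -> (0 < x)%R -> (0 < v)%R ->
  (forall lam, (0 < lam)%R ->
    \int[P]_w (expR (lam * \sum_(k < n) Num.min (D k w / b) 1))%:E <=
      (two_point_mgf lam (v ^+ 2 / n%:R) ^+ n)%:E) ->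
  P [set w | (x / b < \sum_(k < n) Num.min (D k w / b) 1)%R] <=
    (Hfun n (x / b) v)%:E.
Proof.
move=> mD b0 x0 v0 mgf.
have mS := measurable_truncated_sum b mD.
pose S w := (\sum_(k < n) Num.min (D k w / b) 1)%R.
have xb0 : (0 < x / b)%R by rewrite divr_gt0.
have [xn|nx] := ltP (x / b)%R n%:R; last first.
  have -> : [set w | (x / b < S w)%R] = set0.
    apply/seteqP; split => // w /=; rewrite ltNge => /negP; apply.
    apply: le_trans nx; rewrite -[n in leRHS]card_ord -sumr_const.
    by rewrite ler_sum// => k _; rewrite ge_min lexx orbT.
  by rewrite measure0 lee_fin Hfun_ge0.
have [lam lam0 <-] := chernoff_exponent xb0 xn v0.
pose SRV : {RV P >-> R} := HB.pack S (isMeasurableFun.Build _ _ _ _ S mS).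
apply: (@le_trans _ _ (P [set w | (SRV w >= x / b)%R])).
  apply: le_measure; rewrite ?inE.
  - rewrite -[X in measurable X]setTI; exact: measurable_fun_ltr.
  - rewrite -[X in measurable X]setTI; exact: measurable_fun_ler.
  - by move=> w /= /ltW.
apply: (le_trans (chernoff SRV (x / b) lam0)).
rewrite EFinM muleC lee_wpmul2l ?lee_fin ?expR_ge0//.
apply: le_trans (mgf lam lam0).
rewrite /mmt_gen_fun unlock le_eqVlt; apply/orP; left; apply/eqP.
by apply: eq_integral => w _ /=; rewrite mulrC.
Qed.

Lemma truncation_tail (n : nat) (D : nat -> Omega -> R) (b x : R) :
  (forall k, (k < n)%N -> measurable_fun setT (D k)) -> (0 < b)%R ->
  P [set w | (x < \sum_(k < n) D k w)%R] <=
    P [set w | (x / b < \sum_(k < n) Num.min (D k w / b) 1)%R] +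
    \sum_(k < n) P [set w | (b < D k w)%R].
Proof.
move=> mD b0.
pose F k : set Omega := if k is k'.+1 then [set w | (b < D k' w)%R] else
  [set w | (x / b < \sum_(k < n) Num.min (D k w / b) 1)%R].
have mF k : (k < n.+1)%N -> measurable (F k).
  case: k => [_|k kn] /=; rewrite -[X in measurable X]setTI.
    by apply: measurable_fun_ltr => //; exact: measurable_truncated_sum.
  by apply: measurable_fun_ltr => //; exact: mD.
have -> : P [set w | (x / b < \sum_(k < n) Num.min (D k w / b) 1)%R] +
    \sum_(k < n) P [set w | (b < D k w)%R] = \sum_(k < n.+1) P (F k).
  by rewrite big_ord_recl.
apply: content_subadditive => //.
  rewrite -[X in measurable X]setTI; apply: measurable_fun_ltr => //.
  have -> : (fun w => \sum_(k < n) D k w)%R =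
      (fun w => \sum_(k <- enum 'I_n) D k w)%R.
    by apply/funext => w; rewrite big_enum.
  by apply: measurable_sum => k; exact: mD.
move=> w /= xD; rewrite -bigcup_mkord.
have [[k /= kn bD]|noD] := pselect (exists2 k, (k < n)%N & (b < D k w)%R).
  by exists k.+1.
exists 0%N => //=.
have -> : (\sum_(k < n) Num.min (D k w / b) 1 = \sum_(k < n) (D k w / b))%R.
  apply: eq_bigr => k _; apply/min_idPl; rewrite ler_pdivrMr// mul1r leNgt.
  by apply/negP => bD; apply: noD; exists k.
by rewrite -mulr_suml ltr_pM2r// invr_gt0.
Qed.

(** One step of the martingale argument: the factor depending on the next noise
    variable [V] is integrated out first, for each frozen value of the past. *)
Lemma mgf_step d1 d2 (T : measurableType d1) (Y : measurableType d2)
    (U : {RV P >-> T}) (V : {RV P >-> Y}) (Phi : T -> R) (h : T * Y -> R)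
    (lam B : R) :
  (forall A C, measurable A -> measurable C ->
    P (U @^-1` A `&` V @^-1` C) = P (U @^-1` A) * P (V @^-1` C)) ->
  measurable_fun setT Phi -> (forall u, 0 <= Phi u)%R ->
  measurable_fun setT h -> (0 <= B)%R ->
  (forall u, \int[distribution P V]_y (expR (lam * Num.min (h (u, y)) 1))%:E <= B%:E) ->
  \int[P]_w (Phi (U w) * expR (lam * Num.min (h (U w, V w)) 1))%:E <=
    B%:E * \int[P]_w (Phi (U w))%:E.
Proof.
move=> indep mPhi Phi0 mh B0 hB.
have mexp d' (T' : measurableType d') (g : T' -> R) : measurable_fun setT g ->
    measurable_fun setT (fun z => expR (lam * Num.min (g z) 1))%R.
  move=> mg; apply: measurableT_comp => //; apply: measurable_funM => //.
  exact: measurable_minr.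
have mprod : measurable_fun setT (fun z : T * Y =>
    (Phi z.1 * expR (lam * Num.min (h z) 1))%:E).
  apply/measurable_EFinP/measurable_funM; last exact: mexp.
  by apply: measurableT_comp => //; exact: measurable_fst.
rewrite (ge0_freezing indep mprod)/=; last first.
  by move=> z; rewrite lee_fin mulr_ge0 ?expR_ge0.
have mPhiU : measurable_fun setT (fun w => (Phi (U w))%:E).
  by apply/measurable_EFinP; apply: measurableT_comp.
rewrite -ge0_integralZl//; last by move=> w _; rewrite lee_fin.
apply: ge0_le_integral => //.
- by move=> w _; apply: integral_ge0 => y _; rewrite lee_fin mulr_ge0 ?expR_ge0.
- have mG := measurable_fun_fubini_tonelli_F (m2 := distribution P V)
    (fun z : T * Y => (Phi z.1 * expR (lam * Num.min (h z) 1))%:E).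
  apply: (measurableT_comp (mG _ _)) => //.
  by move=> z; rewrite lee_fin mulr_ge0 ?expR_ge0.
- exact: measurable_funeM.
move=> w _; under eq_integral do rewrite EFinM.
rewrite ge0_integralZl ?lee_fin//; last first.
- by apply/measurable_EFinP/mexp; apply: measurableT_comp mh _.
by rewrite muleC lee_wpmul2r// lee_fin.
Qed.

End truncated_sums.

(** * Lipschitz functions and the mean distance to a law *)

Section mean_distance.
Context (R : realType) (E : completeMetricType R) (mu : probability (borel E) R).
Hypotheses (sepE : separable_space E)
  (mean_dist_lty : exists x, (mean_dist mu x < +oo)%E).

Let mdistm x : measurable_fun setT (fun x' : borel E => mdist x x').
Proof. exact: measurable_mdist. Qed.

(** Finiteness of the mean distance at one point propagates to all points by the
    triangle inequality. *)
Lemma integrable_mdist x :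
  mu.-integrable setT (fun x' : borel E => (mdist x x')%:E).
Proof.
have [x0 x0oo] := mean_dist_lty.
have ix0 : mu.-integrable setT (fun x' : borel E => (mdist x0 x')%:E).
  apply/integrableP; split; first exact/measurable_EFinP.
  by under eq_integral do rewrite /= ger0_norm ?mdist_ge0//.
apply: (@le_integrable _ _ _ mu _ measurableT _
    (fun x' : borel E => (mdist x x0)%:E + (mdist x0 x')%:E)%E).
- exact/measurable_EFinP.
- move=> x' _ /=; rewrite lee_fin ger0_norm ?mdist_ge0//.
  by rewrite (le_trans (metric_triangle x x0 x'))// ler_norm.
- by apply: integrableD => //; exact: (finite_measure_integrable_cst mu (mdist x x0)).
Qed.

Definition real_mean_dist x : R := \int[mu]_x' mdist x x'.

Lemma mean_distE x : mean_dist mu x = (real_mean_dist x)%:E.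
Proof.
rewrite /real_mean_dist /Rintegral fineK//.
by rewrite integrable_fin_num// integrable_mdist.
Qed.

Lemma real_mean_dist_ge0 x : 0 <= real_mean_dist x.
Proof. by apply: Rintegral_ge0 => x' _; exact: mdist_ge0. Qed.

Lemma integrable_lipschitz (h : E -> R) (L : R) : 0 <= L ->
  (forall x x', `|h x - h x'| <= L * mdist x x') ->
  mu.-integrable setT (EFin \o (h : borel E -> R)).
Proof.
move=> L0 hL; have [x0 _] := mean_dist_lty.
have mh : measurable_fun setT (h : borel E -> R).
  apply: (@measurable_lipschitz _ _ sepE _ _ (fun _ (x : borel E) => x)
    (fun u => h (u 0%N)) (fun=> L) 1) => // u u'.
  by rewrite big_ord1.
apply: (@le_integrable _ _ _ mu _ measurableT _
    (fun x' : borel E => (`|h x0|)%:E + L%:E * (mdist x0 x')%:E)%E).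
- exact/measurable_EFinP.
- move=> x /= _; rewrite lee_fin [leRHS]ger0_norm ?addr_ge0 ?mulr_ge0 ?mdist_ge0//.
  by rewrite -lerBlDl metric_sym (le_trans _ (hL _ _))// lerB_dist.
- apply: integrableD => //; first exact: (finite_measure_integrable_cst mu `|h x0|).
  by apply: integrableZl => //; exact: integrable_mdist.
Qed.

(** The deviation from the mean is itself an average of the differences
    h x - h x' over x'. *)
Lemma lipschitz_deviation (h : E -> R) (L : R) x : 0 <= L ->
  (forall x x', `|h x - h x'| <= L * mdist x x') ->
  `|h x - \int[mu]_x' h x'| <= L * real_mean_dist x.
Proof.
move=> L0 hL; have ih := integrable_lipschitz L0 hL.
have icst : mu.-integrable setT (EFin \o cst (h x)).
  exact: finite_measure_integrable_cst.
have -> : h x - \int[mu]_x' h x' = \int[mu]_x' (h x - h x').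
  rewrite RintegralB// Rintegral_cst//.
  by rewrite [X in _ * fine X](@probability_setT _ _ _ mu) mulr1.
have iB : mu.-integrable setT (EFin \o (fun z : borel E => h x - h z)).
  by rewrite /comp; under eq_fun do rewrite EFinB; exact: integrableB.
apply: (le_trans (le_normr_Rintegral measurableT iB)).
rewrite -RintegralZl//; last exact: integrable_mdist.
apply: le_Rintegral => //.
- exact: (integrable_norm iB).
- rewrite /comp; under eq_fun do rewrite EFinM.
  by apply: integrableZl => //; exact: integrable_mdist.
Qed.

Lemma real_mean_dist_lipschitz x x' :
  `|real_mean_dist x - real_mean_dist x'| <= 1 * mdist x x'.
Proof.
rewrite -RintegralB//; [|exact: integrable_mdist..].
have iB : mu.-integrable setT (EFin \o (fun z : borel E => mdist x z - mdist x' z)).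
  rewrite /comp; under eq_fun do rewrite EFinB.
  by apply: integrableB => //; exact: integrable_mdist.
apply: (le_trans (le_normr_Rintegral measurableT iB)).
have -> : 1 * mdist x x' = \int[mu]_(z in setT) (cst (mdist x x') z).
  by rewrite Rintegral_cst// [X in fine X](@probability_setT _ _ _ mu) mulr1 mul1r.
apply: le_Rintegral => //.
- exact: (integrable_norm iB).
- exact: finite_measure_integrable_cst.
move=> z _; rewrite ler_norml; have := metric_triangle x x' z.
have := metric_triangle x' x z; rewrite (metric_sym x' x) /cst; lra.
Qed.

Lemma measurable_real_mean_dist :
  measurable_fun setT (real_mean_dist : borel E -> R).
Proof.
have /integrableP[/measurable_EFinP] :=
  integrable_lipschitz ler01 real_mean_dist_lipschitz.
by [].
Qed.

Lemma innovation_moments (h : E -> R) (L b V : R) : 0 <= L -> 0 < b ->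
  (forall x x', `|h x - h x'| <= L * mdist x x') ->
  (\int[mu]_x (real_mean_dist x ^+ 2)%:E <= V%:E)%E ->
  let hc : borel E -> R := fun x => (h x - \int[mu]_x' h x') / b in
  [/\ mu.-integrable setT (EFin \o hc), (\int[mu]_x (hc x)%:E = 0)%E &
      (\int[mu]_x (hc x ^+ 2)%:E <= ((L / b) ^+ 2 * V)%:E)%E].
Proof.
move=> L0 b0 hL hV hc; have ih := integrable_lipschitz L0 hL.
set e := \int[mu]_x' h x' in hc *.
have ie : mu.-integrable setT (EFin \o cst e).
  exact: finite_measure_integrable_cst.
have ihe : mu.-integrable setT (EFin \o (fun x : borel E => h x - e)).
  rewrite /comp; under eq_fun do rewrite EFinB; exact: integrableB.
have ihc : mu.-integrable setT (EFin \o hc).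
  rewrite /comp /hc; under eq_fun do rewrite mulrC EFinM.
  exact: integrableZl.
split => //.
  rewrite -[LHS]fineK; last exact: integrable_fin_num.
  congr EFin; rewrite -/(Rintegral mu setT hc) /hc RintegralZr// RintegralB//.
  rewrite Rintegral_cst// [X in _ * fine X](@probability_setT _ _ _ mu) mulr1.
  by rewrite subrr mul0r.
have mhc : measurable_fun setT hc.
  by have /integrableP[/measurable_EFinP] := ihc.
apply: (@le_trans _ _ (((L / b) ^+ 2)%:E * \int[mu]_x (real_mean_dist x ^+ 2)%:E)%E).
  rewrite -ge0_integralZl ?lee_fin ?sqr_ge0//; last 2 first.
  - by apply/measurable_EFinP; apply: measurable_funX; exact: measurable_real_mean_dist.
  - by move=> x _; rewrite lee_fin sqr_ge0.
  apply: ge0_le_integral => //.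
  - by move=> x _; rewrite lee_fin sqr_ge0.
  - by apply/measurable_EFinP; apply: measurable_funX.
  - apply/measurable_EFinP; apply: measurable_funM => //.
    by apply: measurable_funX; exact: measurable_real_mean_dist.
  - move=> x _; rewrite -EFinM lee_fin -exprMn -(real_normK (num_real (hc x))).
    apply: lerXn2r; rewrite ?nnegrE; first exact: normr_ge0.
      by apply: mulr_ge0; [rewrite divr_ge0 ?(ltW b0)|exact: real_mean_dist_ge0].
    rewrite /hc/= normrM normfV (gtr0_norm b0) mulrAC ler_wpM2r ?invr_ge0 ?(ltW b0)//.
    exact: lipschitz_deviation.
by rewrite [leRHS]EFinM lee_wpmul2l// lee_fin sqr_ge0.
Qed.

End mean_distance.

(** * The martingale increments of the chain *)

Section geosum.
Variables (R : realType) (rho : R).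
Hypothesis rho_ge0 : 0 <= rho.

Lemma geosum0 : geosum rho 0 = 1.
Proof. by rewrite /geosum big_ord1 expr0. Qed.

Lemma geosumS k : geosum rho k.+1 = 1 + rho * geosum rho k.
Proof.
rewrite /geosum big_ord_recl expr0 mulr_sumr; congr (_ + _).
by apply: eq_bigr => i _; rewrite -exprS.
Qed.

Lemma geosum_ge0 k : 0 <= geosum rho k.
Proof. by apply: sumr_ge0 => i _; exact: exprn_ge0. Qed.

Lemma geosum_gt0 k : 0 < geosum rho k.
Proof.
case: k => [|k]; first by rewrite geosum0.
by rewrite geosumS ltr_pwDl// mulr_ge0// geosum_ge0.
Qed.

Lemma geosum_mono k l : (k <= l)%N -> geosum rho k <= geosum rho l.
Proof.
move=> kl; rewrite /geosum -!(big_mkord xpredT (fun i => rho ^+ i)).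
rewrite (@big_cat_nat _ _ _ k.+1 0 l.+1)//= lerDl.
by apply: sumr_ge0 => i _; exact: exprn_ge0.
Qed.

End geosum.

Section chain.
Context (R : realType) (d : measure_display) (Omega : measurableType d)
  (P : probability Omega R) (E Y : completeMetricType R)
  (sepE : separable_space E) (sepY : separable_space Y)
  (eps : nat -> {RV P >-> borel Y})
  (eps_indep : mutually_independent P [set i | (1 <= i)%N] (fun i => eps i))
  (eps_ident : identically_distributed P [set i | (1 <= i)%N] (fun i => eps i))
  (X : nat -> {RV P >-> borel E})
  (X1_indep : independent_of_family P (X 1%N) [set i | (2 <= i)%N]
                (fun i => eps i))
  (F : E * Y -> E)
  (mF : measurable_fun setT (F : borel E * borel Y -> borel E))
  (chain : forall (k : nat) (w : Omega), (2 <= k)%N ->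
     X k w = F (X k.-1 w, eps k w))
  (rho C : R) (rho_ge0 : 0 <= rho) (C_gt0 : 0 < C)
  (F_contr : forall x x' : E,
     ('E_P[fun w => mdist (F (x, eps 1%N w)) (F (x', eps 1%N w))]
        <= (rho * mdist x x')%:E)%E)
  (F_lip : forall (x : E) (y y' : Y),
     mdist (F (x, y)) (F (x, y')) <= C * mdist y y')
  (m : nat) (g : (nat -> E) -> R)
  (g_lip : forall u u', `|g u - g u'| <= \sum_(i < m.+1) mdist (u i) (u' i)).

Let mu : probability (borel Y) R := distribution P (eps 1%N).
Let nu : probability (borel E) R := distribution P (X 1%N).

Hypotheses (mu_lty : exists y, (mean_dist mu y < +oo)%E)
  (nu_lty : exists x, (mean_dist nu x < +oo)%E).

Local Notation K := (geosum rho).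

Definition update (u : nat -> E) k x : nat -> E :=
  fun i => if i == k then x else u i.

(** The mean of [g] given the coordinates 0, ..., k, when j transitions of the
    chain remain; coordinate i stands for X_(i+1). Each step overwrites
    coordinate k+1 by a transition from coordinate k and averages over the
    noise. *)
Fixpoint remaining_mean (j k : nat) (u : nat -> E) : R :=
  if j is j'.+1 then
    \int[mu]_y remaining_mean j' k.+1 (update u k.+1 (F (u k, y)))
  else g u.

Lemma update_lipschitz j k u x x' :
  (forall u u', `|remaining_mean j k.+1 u - remaining_mean j k.+1 u'| <=
     \sum_(i < k.+1) mdist (u i) (u' i) + K j * mdist (u k.+1) (u' k.+1)) ->
  `|remaining_mean j k.+1 (update u k.+1 x) -
    remaining_mean j k.+1 (update u k.+1 x')| <= K j * mdist x x'.
Proof.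
move=> H; apply: (le_trans (H _ _)); rewrite /update eqxx big1 ?add0r// => i _.
by rewrite ltn_eqF// mdistxx.
Qed.

Lemma next_lipschitz j k u y y' :
  (forall u u', `|remaining_mean j k.+1 u - remaining_mean j k.+1 u'| <=
     \sum_(i < k.+1) mdist (u i) (u' i) + K j * mdist (u k.+1) (u' k.+1)) ->
  `|remaining_mean j k.+1 (update u k.+1 (F (u k, y))) -
    remaining_mean j k.+1 (update u k.+1 (F (u k, y')))| <=
  K j * C * mdist y y'.
Proof.
move=> /update_lipschitz H; apply: (le_trans (H _ _ _)).
by rewrite -mulrA ler_wpM2l ?geosum_ge0.
Qed.

Lemma integrable_coupling x x' :
  mu.-integrable setT (EFin \o (fun y : borel Y => mdist (F (x, y)) (F (x', y)))).
Proof.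
apply: (@integrable_lipschitz _ _ mu sepY mu_lty
  (fun y => mdist (F (x, y)) (F (x', y))) (C + C)).
  by rewrite addr_ge0 ?ltW.
move=> y y'; have := F_lip x y y'; have := F_lip x' y y'.
have := metric_triangle (F (x, y)) (F (x, y')) (F (x', y)).
have := metric_triangle (F (x, y')) (F (x', y')) (F (x', y)).
have := metric_triangle (F (x, y')) (F (x, y)) (F (x', y')).
have := metric_triangle (F (x, y)) (F (x', y)) (F (x', y')).
rewrite (metric_sym (F (x, y')) (F (x, y))) (metric_sym (F (x', y')) (F (x', y))).
rewrite ler_norml; lra.
Qed.

Lemma coupling_contraction x x' :
  \int[mu]_y mdist (F (x, y)) (F (x', y)) <= rho * mdist x x'.
Proof.
have ic := integrable_coupling x x'.
rewrite -lee_fin /Rintegral fineK; last exact: integrable_fin_num ic.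
have /integrableP[mc _] := ic.
rewrite /mu ge0_integral_distribution//.
- by have := F_contr x x'; rewrite unlock; exact: id.
- by move=> y; rewrite lee_fin mdist_ge0.
Qed.

(** Coordinate k influences the average both directly, with constant 1, and
    through coordinate k+1, with constant K_j times the mean contraction rho:
    this is the recursion K_(j+1) = 1 + rho K_j. *)
Lemma remaining_mean_lipschitz j k : (k + j = m)%N -> forall u u',
  `|remaining_mean j k u - remaining_mean j k u'| <=
    \sum_(i < k) mdist (u i) (u' i) + K j * mdist (u k) (u' k).
Proof.
elim: j k => [|j IH] k kjm u u'.
  rewrite addn0 in kjm; subst k.
  by rewrite geosum0 mul1r (le_trans (g_lip u u'))// big_ord_recr.
have {}IH := IH k.+1 (etrans (addSnnS _ _) kjm).
pose h u y := remaining_mean j k.+1 (update u k.+1 (F (u k, y))).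
have ih v : mu.-integrable setT (EFin \o (h v : borel Y -> R)).
  apply: (@integrable_lipschitz _ _ mu sepY mu_lty (h v) (K j * C)).
    by rewrite mulr_ge0 ?geosum_ge0// ltW.
  by move=> y y'; exact: next_lipschitz.
have ihh : mu.-integrable setT (EFin \o (fun y : borel Y => h u y - h u' y)).
  rewrite /comp; under eq_fun do rewrite EFinB.
  by apply: integrableB => //; exact: ih.
rewrite /= -/(h u) -/(h u') -RintegralB; [|by []|exact: ih|exact: ih].
apply: (le_trans (le_normr_Rintegral measurableT ihh)).
pose S := \sum_(i < k.+1) mdist (u i) (u' i).
have iS : mu.-integrable setT (EFin \o cst S).
  exact: finite_measure_integrable_cst.
have ic := integrable_coupling (u k) (u' k).
have icK : mu.-integrable setT
    (EFin \o (fun y : borel Y => K j * mdist (F (u k, y)) (F (u' k, y)))).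
  by rewrite /comp; under eq_fun do rewrite EFinM; exact: integrableZl.
apply: (@le_trans _ _ (\int[mu]_y (S + K j * mdist (F (u k, y)) (F (u' k, y))))).
  apply: le_Rintegral => //.
  - exact: (integrable_norm ihh).
  - by rewrite /comp; under eq_fun do rewrite EFinD; exact: integrableD.
  - move=> y _; rewrite /h (le_trans (IH _ _))// /update eqxx lerD2r.
    apply: ler_sum => i _; by rewrite !ltn_eqF.
rewrite RintegralD// Rintegral_cst// [X in _ * fine X](@probability_setT _ _ _ mu).
rewrite mulr1 /S big_ord_recr/= -addrA lerD2l geosumS mulrDl mul1r lerD2l.
rewrite RintegralZl// (mulrC rho) -mulrA ler_wpM2l ?geosum_ge0//.
exact: coupling_contraction.
Qed.

Lemma measurable_remaining_mean j k d' (T : measurableType d')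
    (Z : nat -> T -> borel E) : (k + j = m)%N ->
  (forall i, (i <= k)%N -> measurable_fun setT (Z i)) ->
  measurable_fun setT (fun t => remaining_mean j k (fun i => Z i t)).
Proof.
move=> kjm mZ; apply: (@measurable_lipschitz _ _ sepE _ _ Z (remaining_mean j k)
  (fun i => if (i < k)%N then 1 else K j) k.+1) => //.
  by move=> i; case: ifP => // _; exact: geosum_ge0.
move=> u u'; rewrite big_ord_recr/= ltnn.
rewrite (eq_bigr (fun i : 'I_k => mdist (u i) (u' i))).
  exact: remaining_mean_lipschitz.
by move=> i _; rewrite ltn_ord mul1r.
Qed.

Let path (w : Omega) : nat -> E := fun i => X i.+1 w.

Lemma path_update w k :
  update (path w) k.+1 (F (path w k, eps k.+2 w)) = path w.
Proof.
apply/funext => i; rewrite /update; case: eqP => // ->.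
by rewrite /path (chain (k := k.+2)).
Qed.

(* The sample space carrying only the information of X_1, eps_2, ..., eps_k. *)
Let hist (k : nat) := g_sigma_algebraType (history (X 1%N) eps k).

Lemma measurable_path_history i k : (i <= k)%N ->
  measurable_fun setT (X i.+1 : hist k.+1 -> borel E).
Proof.
elim: i => [|i IH] ik; first exact: measurable_init_history.
have -> : (X i.+2 : hist k.+1 -> borel E) =
    (F : borel E * borel Y -> borel E) \o
      (fun w : hist k.+1 => (X i.+1 w, eps i.+2 w)).
  by apply/funext => w /=; rewrite (chain (k := i.+2)).
apply: measurableT_comp => //; apply: measurable_fun_pair.
  by apply: IH; exact: ltnW.
exact: measurable_innov_history.
Qed.

Definition first_value (x : E) : R := remaining_mean m 0 (fun=> x).

(** The martingale increments of g(X_1, ..., X_(m+1)): [increment k] is the one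
    at time k+1, and the one at time 1 compares with the unconditional mean. *)
Definition increment (k : nat) (w : Omega) : R :=
  if k is k'.+1 then
    remaining_mean (m - k) k (path w) - remaining_mean (m - k') k' (path w)
  else first_value (X 1%N w) - \int[nu]_x first_value x.

(** The increment at time k+2 as a function of the past and of a free value of
    the noise, the form in which the noise can be integrated out. *)
Definition innovation (k : nat) (z : Omega * Y) : R :=
  remaining_mean (m - k.+1) k.+1
    (update (path z.1) k.+1 (F (path z.1 k, z.2))) -
  remaining_mean (m - k) k (path z.1).

Lemma increment_innovation k w : increment k.+1 w = innovation k (w, eps k.+2 w).
Proof. by rewrite /innovation /= path_update. Qed.

Lemma first_valueE w : remaining_mean m 0 (path w) = first_value (X 1%N w).
Proof.
apply/eqP; rewrite -subr_eq0 -normr_le0.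
have := @remaining_mean_lipschitz m 0%N (add0n m) (path w) (fun=> X 1%N w).
by rewrite big_ord0 /path mdistxx mulr0 addr0.
Qed.

Lemma sum_increment k w : (k <= m)%N ->
  \sum_(j < k.+1) increment j w =
  remaining_mean (m - k) k (path w) - \int[nu]_x first_value x.
Proof.
elim: k => [_|k IH km]; first by rewrite big_ord1 /= subn0 first_valueE.
by rewrite big_ord_recr/= IH ?(ltnW km)//; lra.
Qed.

Lemma measurable_increment_history k l : (k <= l <= m)%N ->
  measurable_fun setT (increment k : hist l.+1 -> R).
Proof.
move=> /andP[kl lm].
have mrem i : (i <= l)%N -> measurable_fun setT
    (fun w : hist l.+1 => remaining_mean (m - i) i (path w)).
  move=> il; apply: (measurable_remaining_mean (T := hist l.+1)
    (Z := fun i (w : hist l.+1) => X i.+1 w)).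
    by rewrite subnKC// (leq_trans il).
  by move=> i' i'i; apply: measurable_path_history; exact: leq_trans il.
case: k kl => [|k] kl; apply: measurable_funB => //.
- apply: (measurableT_comp (f := (first_value : borel E -> R))).
    exact: (measurable_remaining_mean (T := borel E) (Z := fun _ x => x)).
  exact: measurable_init_history.
- exact: mrem.
- by apply: mrem; exact: ltnW.
Qed.

Lemma measurable_increment k : (k <= m)%N -> measurable_fun setT (increment k).
Proof.
move=> km; have mk := @measurable_increment_history k k.
rewrite leqnn km in mk.
exact: (measurableT_comp (mk isT)
  (@measurable_id_history _ _ _ _ _ _ _ _ (X 1%N) eps k.+1)).
Qed.

Lemma measurable_innovation k : (k < m)%N ->
  measurable_fun setT (innovation k : hist k.+1 * borel Y -> R).
Proof.
move=> km.
pose Z i (z : hist k.+1 * borel Y) : borel E :=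
  if i == k.+1 then F (X k.+1 z.1, z.2) else X i.+1 z.1.
have mX i : (i <= k)%N -> measurable_fun setT
    (fun z : hist k.+1 * borel Y => X i.+1 z.1).
  move=> ik; exact: (measurableT_comp (measurable_path_history ik) measurable_fst).
apply: measurable_funB.
  apply: (measurable_remaining_mean (Z := Z)); first by rewrite subnKC.
  move=> i; rewrite leq_eqVlt => /predU1P[->|].
    rewrite /Z eqxx; apply: (measurableT_comp mF).
    by apply: measurable_fun_pair => //; exact: mX.
  rewrite ltnS => ik; rewrite /Z ltn_eqF//; exact: mX.
apply: (measurable_remaining_mean (T := (hist k.+1 * borel Y)%type)
  (Z := fun i z => X i.+1 z.1)).
  by rewrite subnKC// ltnW.
exact: mX.
Qed.

Lemma first_value_lipschitz x x' :
  `|first_value x - first_value x'| <= K m * mdist x x'.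
Proof.
have := @remaining_mean_lipschitz m 0%N (add0n m) (fun=> x) (fun=> x').
by rewrite big_ord0 add0r.
Qed.

Lemma innovation_lipschitz k u y y' : (k < m)%N ->
  `|remaining_mean (m - k.+1) k.+1 (update u k.+1 (F (u k, y))) -
    remaining_mean (m - k.+1) k.+1 (update u k.+1 (F (u k, y')))| <=
  K (m - k.+1) * C * mdist y y'.
Proof.
by move=> km; apply: next_lipschitz; apply: remaining_mean_lipschitz; rewrite subnKC.
Qed.

Lemma innovationE k w y : (k < m)%N ->
  let h y := remaining_mean (m - k.+1) k.+1
    (update (path w) k.+1 (F (path w k, y))) in
  innovation k (w, y) = h y - \int[mu]_y' h y'.
Proof. by move=> km h; rewrite /innovation -(subnSK km). Qed.

Lemma increment0_le w :
  `|increment 0 w| <= K m * real_mean_dist nu (X 1%N w).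
Proof.
apply: (lipschitz_deviation sepE nu_lty); first exact: geosum_ge0.
exact: first_value_lipschitz.
Qed.

Lemma incrementS_le k w : (k < m)%N ->
  `|increment k.+1 w| <= K (m - k.+1) * C * real_mean_dist mu (eps k.+2 w).
Proof.
move=> km; rewrite increment_innovation innovationE//.
apply: (lipschitz_deviation sepY mu_lty).
  by rewrite mulr_ge0 ?geosum_ge0// ltW.
by move=> y y'; exact: innovation_lipschitz.
Qed.

Lemma integral_eps k (h : borel Y -> \bar R) :
  (\int[distribution P (eps k.+1)]_y h y = \int[mu]_y h y)%E.
Proof.
apply: eq_measure_integral => A mA _.
exact: eps_ident.
Qed.

Lemma history_independence k (A : set (hist k.+1)) (B : set (borel Y)) :
  measurable A -> measurable B ->
  P (A `&` eps k.+2 @^-1` B) = (P A * P (eps k.+2 @^-1` B))%E.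
Proof.
by move=> mA mB; exact: (history_indep eps_indep X1_indep (ltn0Sn k) mA mB).
Qed.

(* The past as a random variable: the identity into the coarser space. *)
Let id_hist k : Omega -> hist k := id.

Let measurable_id_hist k : measurable_fun setT (id_hist k).
Proof. exact: measurable_id_history. Qed.

HB.instance Definition _ k :=
  isMeasurableFun.Build _ _ _ _ (id_hist k) (@measurable_id_hist k).

Section moments.
Variables (V1 W : R).
Hypotheses (nuV1 : (\int[nu]_x (real_mean_dist nu x ^+ 2)%:E <= V1%:E)%E)
  (muW : (\int[mu]_y (real_mean_dist mu y ^+ 2)%:E <= W%:E)%E).

(** Bounds on the conditional second moments of the increments divided by b. *)
Definition variance_bound (b : R) (k : nat) : R :=
  if k is k'.+1 then (K (m - k) * C / b) ^+ 2 * W else (K m / b) ^+ 2 * V1.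

(** Peeling off the increments from the last one to the first; the exponents
    c (s_j - t) add up, and vanish in total for t the average of the s_j. *)
Lemma increments_mgf b lam t : 0 < b -> 0 < lam -> 0 < t ->
  exists c : R, forall k, (k <= m)%N ->
  (\int[P]_w (expR (lam * \sum_(j < k.+1) Num.min (increment j w / b) 1))%:E <=
    (two_point_mgf lam t ^+ k.+1 *
     expR (c * \sum_(j < k.+1) (variance_bound b j - t)))%:E)%E.
Proof.
move=> b0 lam0 t0; have [c Hc] := truncated_mgf_le lam0 t0.
exists c; elim=> [_|k IH km].
  under eq_integral do rewrite big_ord1.
  rewrite big_ord1 expr1.
  have [i1 z1 s1] := innovation_moments sepE nu_lty (geosum_ge0 rho_ge0 m) b0
    first_value_lipschitz nuV1.
  have := Hc _ _ nu _ _ i1 z1 s1; rewrite ge0_integral_distribution//.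
  apply/measurable_EFinP; apply: measurableT_comp => //.
  apply: measurable_funM => //; apply: measurable_minr => //.
  by have /integrableP[/measurable_EFinP] := i1.
pose Phi (w : hist k.+1) :=
  expR (lam * \sum_(j < k.+1) Num.min (increment j w / b) 1).
have mPhi : measurable_fun setT Phi.
  apply: measurableT_comp => //; apply: measurable_funM => //.
  apply: measurable_truncated_sum => j jk.
  by apply: measurable_increment_history; rewrite -ltnS jk ltnW.
have B0 : 0 <= two_point_mgf lam t * expR (c * (variance_bound b k.+1 - t)).
  by apply: mulr_ge0; [exact/ltW/two_point_mgf_gt0|exact: expR_ge0].
have Phi0 (u : hist k.+1) : 0 <= Phi u by exact: expR_ge0.
have mh : measurable_fun setT (fun z : hist k.+1 * borel Y => innovation k z / b).
  by apply: measurable_funM => //; exact: measurable_innovation.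
have step := @mgf_step _ _ _ P _ _ _ _ (id_hist k.+1) (eps k.+2) Phi _ lam _
  (@history_independence k) mPhi Phi0 mh B0.
have -> : (\int[P]_w (expR (lam * \sum_(j < k.+2) Num.min (increment j w / b) 1))%:E =
   \int[P]_w (Phi (id_hist k.+1 w) *
     expR (lam * Num.min (innovation k (id_hist k.+1 w, eps k.+2 w) / b) 1))%:E)%E.
  apply: eq_integral => w _; congr EFin.
  by rewrite big_ord_recr mulrDr expRD increment_innovation.
apply: (le_trans (step _)).
  move=> w; rewrite integral_eps.
  have KC0 : 0 <= K (m - k.+1) * C by rewrite mulr_ge0 ?geosum_ge0// ltW.
  have [i1 z1 s1] := innovation_moments sepY mu_lty KC0 b0
    (fun y y' => innovation_lipschitz (path w) y y' km) muW.
  have := Hc _ _ mu _ _ i1 z1 s1.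
  under eq_integral do rewrite -innovationE//.
  exact: id.
apply: le_trans.
  apply: lee_wpmul2l; [by rewrite lee_fin|exact: IH (ltnW km)].
rewrite -EFinM lee_fin le_eqVlt; apply/orP; left; apply/eqP.
rewrite (exprS _ k.+1) [in RHS]big_ord_recr [in RHS]mulrDr [in RHS]expRD.
ring.
Qed.

Lemma increment_mean0 k : (k <= m)%N ->
  P.-integrable setT (EFin \o increment k) /\
  (\int[P]_w (increment k w)%:E = 0)%E.
Proof.
case: k => [_|k km].
  have [i1 z1 _] := innovation_moments sepE nu_lty (geosum_ge0 rho_ge0 m) ltr01
    first_value_lipschitz nuV1.
  have E0 : increment 0 = (fun x : borel E =>
      (first_value x - \int[nu]_x' first_value x') / 1) \o X 1%N.
    by apply/funext => w /=; rewrite divr1.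
  have iX := integrable_comp i1.
  rewrite E0; split => //.
  rewrite -[RHS]z1 integral_distribution//.
  by have /integrableP[] := i1.
have ik : P.-integrable setT (EFin \o increment k.+1).
  have KC0 : 0 <= K (m - k.+1) * C by rewrite mulr_ge0 ?geosum_ge0// ltW.
  have imd : (distribution P (eps k.+2)).-integrable setT
      (EFin \o (fun y => K (m - k.+1) * C * real_mean_dist mu y)).
    apply/integrableP; split.
      apply/measurable_EFinP; apply: measurable_funM => //.
      exact: (measurable_real_mean_dist sepY mu_lty).
    rewrite integral_eps.
    have := @integrable_lipschitz _ _ mu sepY mu_lty
      (fun y => K (m - k.+1) * C * real_mean_dist mu y) (K (m - k.+1) * C) KC0.
    case/(_ _)/integrableP => // y y'.
    rewrite -mulrBr normrM ger0_norm// ler_wpM2l//.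
    by have := real_mean_dist_lipschitz mu_lty y y'; rewrite mul1r.
  apply: le_integrable (integrable_comp imd) => //.
    by apply/measurable_EFinP; exact: measurable_increment.
  by move=> w _; rewrite lee_fin (le_trans (incrementS_le _ km))// ler_norm.
split => //.
have EI w : increment k.+1 w = innovation k (id_hist k.+1 w, eps k.+2 w).
  exact: increment_innovation.
under eq_integral do rewrite EI.
apply: (@freezing_mean0 _ _ _ _ _ _ _ P (id_hist k.+1) (eps k.+2) _
  (innovation k)).
- exact: history_independence.
- exact: measurable_innovation.
- by apply: eq_integrable ik => // w _; exact: (congr1 EFin (EI w)).
- move=> w; rewrite integral_eps.
  have KC0 : 0 <= K (m - k.+1) * C by rewrite mulr_ge0 ?geosum_ge0// ltW.
  have [_ z1 _] := innovation_moments sepY mu_lty KC0 ltr01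
    (fun y y' => innovation_lipschitz (path w) y y' km) muW.
  rewrite -[RHS]z1; apply: eq_integral => y _.
  by rewrite divr1 -innovationE.
Qed.

Lemma path_value w :
  g (path w) = \sum_(k < m.+1) increment k w + \int[nu]_x first_value x.
Proof. by rewrite sum_increment// subnn subrK. Qed.

Lemma path_mean : P.-integrable setT (EFin \o (g \o path)) /\
  ('E_P[g \o path] = (\int[nu]_x first_value x)%:E)%E.
Proof.
set e := \int[nu]_x first_value x.
have isum : P.-integrable setT (fun w => \sum_(k < m.+1) (increment k w)%:E)%E.
  apply: integrable_sum => // k _.
  by have [] := increment_mean0 (ltn_ord k : (k <= m)%N).
have icst : P.-integrable setT (EFin \o cst e).
  exact: finite_measure_integrable_cst.
have gE : EFin \o (g \o path) =
    (fun w => (\sum_(k < m.+1) (increment k w)%:E) + (cst e w)%:E)%E.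
  by apply/funext => w /=; rewrite path_value EFinD -sumEFin.
split; first by rewrite gE; exact: integrableD.
rewrite unlock (_ : (fun w => ((g \o path) w)%:E) = EFin \o (g \o path))// gE.
rewrite integralD// integral_sum//; last first.
  by move=> k; have [] := increment_mean0 (ltn_ord k : (k <= m)%N).
rewrite big1 ?add0e; last first.
  by move=> k _; have [] := increment_mean0 (ltn_ord k : (k <= m)%N).
have := integral_cst P measurableT e%:E.
by rewrite /= probability_setT mule1.
Qed.

Lemma sum_variance_bound b : \sum_(k < m.+1) variance_bound b k =
  (V1 * K m ^+ 2 + C ^+ 2 * W * \sum_(2 <= i < m.+2) K (m.+1 - i) ^+ 2) / b ^+ 2.
Proof.
rewrite big_ord_recl/= mulrDl; congr (_ + _).
  by rewrite expr_div_n; ring.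
rewrite -[2%N]addn1 big_addn subSS subn0 big_add1 big_mkord mulr_sumr mulr_suml.
apply: eq_bigr => k _; rewrite /bump leq0n add1n.
have -> : (m.+1 - (k.+1 + 1))%N = (m - k.+1)%N by rewrite addn1 subSS.
rewrite expr_div_n exprMn; ring.
Qed.

(** The two sources of the bound, the truncated sum and the large increments,
    are estimated with b = y K_m: as K_(m-k) <= K_m, an increment above b forces
    its dominating variable above y. *)
Lemma chain_deviation (x y a1 a2 V : R) : 0 < x -> 0 < y -> 0 < V1 -> 0 < W ->
  (P [set w | (y < real_mean_dist nu (X 1%N w))%R] <= a1%:E)%E ->
  (P [set w | (y < C * real_mean_dist mu (eps 1%N w))%R] <= a2%:E)%E ->
  V = V1 * K m ^+ 2 + C ^+ 2 * W * \sum_(2 <= i < m.+2) K (m.+1 - i) ^+ 2 ->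
  (P [set w | (x < centered P (g \o path) w)%R] <=
   (Hfun m.+1 (x / (y * K m)) (Num.sqrt V / (y * K m)) + (a1 + m%:R * a2))%:E)%E.
Proof.
move=> x0 y0 V10 W0 Pa1 Pa2 VE.
have Km0 : 0 < K m := geosum_gt0 rho_ge0 m.
have V0 : 0 < V.
  rewrite VE ltr_wpDr ?mulr_gt0 ?exprn_gt0// mulr_ge0//.
    by rewrite mulr_ge0 ?sqr_ge0// ltW.
  by apply: sumr_ge0 => i _; exact: sqr_ge0.
pose b := y * K m; have b0 : 0 < b by rewrite mulr_gt0.
pose v := Num.sqrt V / b; have v0 : 0 < v by rewrite divr_gt0// sqrtr_gt0.
have centeredE w : centered P (g \o path) w = \sum_(k < m.+1) increment k w.
  by rewrite /centered path_mean.2 /= path_value addrK.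
rewrite (_ : [set w | _] = [set w | x < \sum_(k < m.+1) increment k w]); last first.
  by apply/seteqP; split => w /=; rewrite centeredE.
have mD k : (k < m.+1)%N -> measurable_fun setT (increment k).
  by rewrite ltnS; exact: measurable_increment.
apply: (le_trans (truncation_tail P x mD b0)).
rewrite EFinD; apply: leeD.
  apply: truncated_sum_tail => // lam lam0.
  have t0 : 0 < v ^+ 2 / m.+1%:R by rewrite divr_gt0// exprn_gt0.
  have [c /(_ m (leqnn m))] := increments_mgf b0 lam0 t0.
  suff -> : \sum_(j < m.+1) (variance_bound b j - v ^+ 2 / m.+1%:R) = 0.
    by rewrite mulr0 expR0 mulr1.
  rewrite sumrB sum_variance_bound -VE sumr_const card_ord /v.
  rewrite expr_div_n sqr_sqrtr ?ltW//.
  by rewrite -[X in _ - X]mulr_natr divfK ?subrr// pnatr_eq0.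
have Dnu w : real_mean_dist nu w >= 0 := real_mean_dist_ge0 nu w.
have Dmu w : real_mean_dist mu w >= 0 := real_mean_dist_ge0 mu w.
have mmu : measurable_fun setT (fun y' : borel Y => C * real_mean_dist mu y').
  apply: measurable_funM => //; exact: (measurable_real_mean_dist sepY mu_lty).
have mset_gt (Z : Omega -> R) (r : R) :
    measurable_fun setT Z -> measurable [set w | r < Z w].
  by move=> mZ; rewrite -[X in measurable X]setTI; exact: measurable_fun_ltr.
rewrite big_ord_recl EFinD; apply: leeD.
  apply: le_trans Pa1; apply: le_measure; rewrite ?inE.
  - exact/mset_gt/mD.
  - apply: mset_gt.
    apply: (measurableT_comp (f := real_mean_dist nu : borel E -> R)) => //.
    exact: (measurable_real_mean_dist sepE nu_lty).
  - move=> w /= bD; have := le_trans (ler_norm _) (increment0_le w).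
    move=> /(lt_le_trans bD); rewrite /b (mulrC y) ltr_pM2l//.
have -> : (m%:R * a2)%:E = (\sum_(k < m) a2%:E)%E.
  by rewrite sumEFin sumr_const card_ord mulr_natl.
apply: lee_sum => k _; rewrite lift0.
have km := ltn_ord k.
pose B := [set y' : borel Y | y < C * real_mean_dist mu y'].
have mB : measurable B by rewrite -[X in measurable X]setTI; exact: measurable_fun_ltr.
apply: (@le_trans _ _ (P (eps k.+2 @^-1` B))).
  apply: le_measure; rewrite ?inE.
  - by apply: mset_gt; apply: mD.
  - exact: preimage_measurable.
  - move=> w /= bD; have := le_trans (ler_norm _) (incrementS_le w km).
    move=> /(lt_le_trans bD); rewrite -mulrA => bK.
    rewrite /B/= -(ltr_pM2l Km0) mulrC (lt_le_trans bK)// ler_wpM2r//.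
      by rewrite mulr_ge0// ltW.
    by apply: geosum_mono => //; exact: leq_subr.
by rewrite (eps_ident (i := k.+2) (j := 1%N)).
Qed.

End moments.

End chain.

(** * The deviation inequality *)

Section moment_consequences.
Context d (Omega : measurableType d) (R : realType) (P : probability Omega R).

(** The constant +oo has no finite second moment on a probability space. *)
Lemma square_integral_lty (Z : Omega -> \bar R) (V : R) :
  (forall w, (0 <= Z w)%E) -> (\int[P]_w (Z w ^+ 2) <= V%:E)%E ->
  exists w, (Z w < +oo)%E.
Proof.
move=> Z0 ZV; apply: contrapT => noZ.
have Zoo w : Z w = +oo%E.
  by apply/eqP; rewrite -leye_eq leNgt; apply/negP => Zw; apply: noZ; exists w.
move: ZV; under eq_integral do rewrite Zoo expe2 mulyy.
have := integral_cst P measurableT +oo%E.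
by rewrite /= probability_setT mule1 => ->; rewrite leye_eq.
Qed.

Lemma weak_moment_tail (Z : Omega -> R) (p A y : R) :
  measurable_fun setT Z -> 0 < y ->
  (weak_moment P (fun w => (Z w)%:E) p <= A%:E)%E ->
  (P [set w | (y < Z w)%R] <= (A / y `^ p)%:E)%E.
Proof.
move=> mZ y0 ZA; have yp0 : 0 < y `^ p by exact: powR_gt0.
rewrite mulrC EFinM lee_pdivlMl//.
apply: le_trans ZA.
apply: (@le_trans _ _ ((y `^ p)%:E * P [set w | (y%:E < `|(Z w)%:E|)%E])%E).
  rewrite lee_wpmul2l ?lee_fin ?powR_ge0//; apply: le_measure; rewrite ?inE.
  - by rewrite -[X in measurable X]setTI; exact: measurable_fun_ltr.
  - rewrite -[X in measurable X]setTI /=; under eq_set do rewrite lte_fin.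
    by apply: measurable_fun_ltr => //; exact: measurableT_comp.
  - by move=> w /= yZ; rewrite lte_fin (lt_le_trans yZ)// ler_norm.
by apply: ereal_sup_ubound; exists y.
Qed.

End moment_consequences.

Theorem proposition3p9
  (R : realType) (d : measure_display) (Omega : measurableType d)
  (P : probability Omega R)
  (E Y : completeMetricType R)
  (sepE : separable_space E) (sepY : separable_space Y)
  (eps : nat -> {RV P >-> borel Y})
  (eps_indep : mutually_independent P [set i | (1 <= i)%N] (fun i => eps i))
  (eps_ident : identically_distributed P [set i | (1 <= i)%N] (fun i => eps i))
  (X : nat -> {RV P >-> borel E})
  (X1_indep : independent_of_family P (X 1%N) [set i | (2 <= i)%N]
                (fun i => eps i))
  (F : E * Y -> E)
  (mF : measurable_fun setT (F : borel E * borel Y -> borel E))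
  (chain : forall (k : nat) (w : Omega), (2 <= k)%N ->
     X k w = F (X k.-1 w, eps k w))
  (rho C : R) (rho_ge0 : 0 <= rho) (rho_lt1 : rho < 1) (C_gt0 : 0 < C)
  (F_contr : forall x x' : E,
     ('E_P[fun w => mdist (F (x, eps 1%N w)) (F (x', eps 1%N w))]
        <= (rho * mdist x x')%:E)%E)
  (F_lip : forall (x : E) (y y' : Y),
     mdist (F (x, y)) (F (x, y')) <= C * mdist y y')
  (n : nat) (n_ge1 : (1 <= n)%N)
  (f : ('I_n -> E) -> R)
  (f_lip : forall x x' : 'I_n -> E,
     `|f x - f x'| <= \sum_(i < n) mdist (x i) (x' i))
  (p : R) (p_gt2 : 2 < p)
  (V1 V2 A1 A2 : R)
  (V1_gt0 : 0 < V1) (V2_gt0 : 0 < V2) (A1_gt0 : 0 < A1) (A2_gt0 : 0 < A2) :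
  let Sn := centered P (fun w => f (fun i : 'I_n => X i.+1 w)) in
  let GX := mean_dist (distribution P (X 1%N)) in
  let Geps := fun y : Y =>
    (\int[distribution P (eps 1%N)]_y' (C * mdist y y')%:E)%E in
  (\int[P]_w (GX (X 1%N w) ^+ 2) <= V1%:E)%E ->
  (\int[P]_w (Geps (eps 1%N w) ^+ 2) <= V2%:E)%E ->
  (weak_moment P (fun w => GX (X 1%N w)) p <= A1%:E)%E ->
  (weak_moment P (fun w => Geps (eps 1%N w)) p <= A2%:E)%E ->
  let K := geosum rho in
  let V := V1 * K n.-1 ^+ 2 + V2 * \sum_(2 <= i < n.+1) K (n - i)%N ^+ 2 in
  let A := A1 + (n.-1)%:R * A2 in
  forall x y : R, 0 < x -> 0 < y ->
  let bound :=
    Hfun n (x / (y * K n.-1)) (Num.sqrt V / (y * K n.-1)) + A / y `^ p in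
  (P [set w | (x < Sn w)%R] <= bound%:E)%E /\
  (P [set w | (x < - Sn w)%R] <= bound%:E)%E.
Proof.
case: n n_ge1 f f_lip => // m _ {}f {}f_lip.
move=> Sn GX Geps hV1 hV2 hA1 hA2 K V A x y x0 y0.
pose nu : probability (borel E) R := distribution P (X 1%N).
pose mu : probability (borel Y) R := distribution P (eps 1%N).
have GX_ge0 w : (0 <= GX (X 1%N w))%E.
  by apply: integral_ge0 => x' _; rewrite lee_fin mdist_ge0.
have GepsE z : Geps z = (C%:E * mean_dist mu z)%E.
  rewrite /Geps; under eq_integral do rewrite EFinM.
  rewrite ge0_integralZl// ?lee_fin ?ltW//.
  - by apply/measurable_EFinP; exact: measurable_mdist.
  - by move=> z' _; rewrite lee_fin mdist_ge0.
have Geps_ge0 w : (0 <= Geps (eps 1%N w))%E.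
  by apply: integral_ge0 => z' _; rewrite lee_fin mulr_ge0 ?mdist_ge0// ltW.
have nu_lty : exists z, (mean_dist nu z < +oo)%E.
  by have [w ?] := square_integral_lty GX_ge0 hV1; exists (X 1%N w).
have mu_lty : exists z, (mean_dist mu z < +oo)%E.
  have [w] := square_integral_lty Geps_ge0 hV2; exists (eps 1%N w).
  rewrite ltNge leye_eq; apply/negP => /eqP muoo.
  by move: p0; rewrite GepsE muoo gt0_muley ?lte_fin// ltxx.
have GXE z : GX z = (real_mean_dist nu z)%:E := mean_distE nu_lty z.
have GepsrE z : Geps z = (C * real_mean_dist mu z)%:E.
  by rewrite GepsE (mean_distE mu_lty) EFinM.
have mnu := measurable_real_mean_dist sepE nu_lty.
have mmu := measurable_real_mean_dist sepY mu_lty.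
have nuV1 : (\int[nu]_z (real_mean_dist nu z ^+ 2)%:E <= V1%:E)%E.
  rewrite ge0_integral_distribution//.
  - apply: le_trans hV1; rewrite le_eqVlt; apply/orP; left; apply/eqP.
    by apply: eq_integral => w _; rewrite GXE -EFin_expe.
  - by apply/measurable_EFinP; exact: measurable_funX.
  - by move=> z; rewrite lee_fin sqr_ge0.
(* The second moment hypothesis concerns C times the mean distance. *)
have muW : (\int[mu]_z (real_mean_dist mu z ^+ 2)%:E <= (V2 / C ^+ 2)%:E)%E.
  rewrite mulrC EFinM lee_pdivlMl ?exprn_gt0//.
  rewrite -ge0_integralZl ?lee_fin ?sqr_ge0//; last 2 first.
  - by apply/measurable_EFinP; exact: measurable_funX.
  - by move=> z _; rewrite lee_fin sqr_ge0.
  rewrite ge0_integral_distribution//.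
  - apply: le_trans hV2; rewrite le_eqVlt; apply/orP; left; apply/eqP.
    by apply: eq_integral => w _; rewrite GepsrE -EFin_expe exprMn EFinM.
  - apply/measurable_EFinP; apply: measurable_funM => //; exact: measurable_funX.
  - by move=> z; rewrite -EFinM lee_fin mulr_ge0// sqr_ge0.
have Pa1 : (P [set w | (y < real_mean_dist nu (X 1%N w))%R] <= (A1 / y `^ p)%:E)%E.
  apply: weak_moment_tail => //; first exact: (measurableT_comp mnu).
  by under eq_fun do rewrite -GXE.
have Pa2 : (P [set w | (y < C * real_mean_dist mu (eps 1%N w))%R] <=
    (A2 / y `^ p)%:E)%E.
  apply: (weak_moment_tail (Z := fun w => C * real_mean_dist mu (eps 1%N w))) => //.
    by apply: measurable_funM => //; exact: (measurableT_comp mmu).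
  by under eq_fun do rewrite -GepsrE.
pose path w i := X i.+1 w.
have bound g (g_lip : forall u u' : nat -> E,
    `|g u - g u'| <= \sum_(i < m.+1) mdist (u i) (u' i)) :
    (P [set w | (x < centered P (g \o path) w)%R] <=
     (Hfun m.+1 (x / (y * K m)) (Num.sqrt V / (y * K m)) + A / y `^ p)%:E)%E.
  have -> : A / y `^ p = A1 / y `^ p + m%:R * (A2 / y `^ p).
    by rewrite /A mulrDl -mulrA.
  apply: (chain_deviation sepE sepY eps_indep eps_ident X1_indep mF chain
    rho_ge0 C_gt0 F_contr F_lip g_lip mu_lty nu_lty nuV1 muW x0 y0 V1_gt0 _ Pa1 Pa2).
    by rewrite divr_gt0// exprn_gt0.
  by rewrite (mulrC (C ^+ 2)) divfK// gt_eqF// exprn_gt0.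
pose g (u : nat -> E) := f (fun i : 'I_m.+1 => u i).
have g_lip u u' : `|g u - g u'| <= \sum_(i < m.+1) mdist (u i) (u' i).
  exact: f_lip.
have Ng_lip u u' : `|(- g u) - (- g u')| <= \sum_(i < m.+1) mdist (u i) (u' i).
  by rewrite -opprD normrN.
have [ig _] := path_mean sepE sepY eps_indep eps_ident X1_indep mF chain
  rho_ge0 C_gt0 F_contr F_lip g_lip mu_lty nu_lty nuV1 muW.
split; first exact: (bound g g_lip).
(* Integrability is needed here: the mean of - Z is minus that of Z. *)
have NSn w : - Sn w = centered P ((fun u => - g u) \o path) w.
  rewrite /Sn /centered opprB addrC; congr (_ + _).
  rewrite unlock.
  rewrite -[LHS]opprK; congr (- _).
  by rewrite -mulN1r -RintegralZl//; apply: eq_Rintegral => z _; rewrite mulN1r.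
have -> : [set w | x < - Sn w] =
    [set w | x < centered P ((fun u => - g u) \o path) w].
  by apply/seteqP; split => w /=; rewrite NSn.
exact: (bound (fun u => - g u) Ng_lip).
Qed.
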